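(* For every $\rho \in \mathcal{S}$ and $\sigma \in \mathcal{P}$, $D^{\mathbb{P}}(\rho\|\sigma) = D^{\mathbb{M}}(\rho\|\sigma)$.
   Context: Work on a $d$-dimensional complex Hilbert space. $\mathcal{P}$ denotes the positive semidefinite operators, $\mathcal{S}$ the density operators; $\log$ is the natural logarithm. For a probability measure $P$ and a positive measure $Q$ on a finite set $\mathcal{X}$, the Kullback–Leibler divergence is $D(P\|Q)=\sum_x P(x)\log\frac{P(x)}{Q(x)}$ (terms with $P(x)=0$ are $0$), and $D(P\|Q)=+\infty$ if $P$ is not absolutely continuous w.r.t. $Q$. A POVM on a finite set $\mathcal{X}$ is a map $M$ from $\mathcal{X}$ to positive semidefinite operators with $\sum_x M(x)=1$; it induces the measure $P_{\rho,M}(x)=\operatorname{tr}[M(x)\rho]$. The measured relative entropy is $D^{\mathbb{M}}(\rho\|\sigma):=\sup_{(\mathcal{X},M)} D(P_{\rho,M}\|P_{\sigma,M})$, supremum over all finite sets $\mathcal{X}$ and POVMs $M$ on $\mathcal{X}$. The projectively measured relative entropy is \[ D^{\mathbb{P}}(\rho\|\sigma) := \sup_{ \{ P_i \}_{i=1}^d} \sum_{i=1}^d \operatorname{tr} [P_i \rho] \log \frac{\operatorname{tr} [P_i \rho]}{\operatorname{tr} [P_i \sigma]}, \] supremum over families of $d$ mutually orthogonal rank-one projectors (same conventions for $0$ and $\infty$). *)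

(* Defs.v *)
From Stdlib Require Import Reals Bool.
Open Scope R_scope.

Definition C : Type := (R * R)%type.
Definition C0 : C := (0, 0).
Definition C1 : C := (1, 0).
Definition Cadd (a b : C) : C := (fst a + fst b, snd a + snd b).
Definition Cmul (a b : C) : C :=
  (fst a * fst b - snd a * snd b, fst a * snd b + snd a * fst b).
Definition Cconj (a : C) : C := (fst a, - snd a).
Definition Re (a : C) : R := fst a.

Fixpoint sumC (n : nat) (f : nat -> C) : C :=
  match n with O => C0 | S k => Cadd (sumC k f) (f k) end.
Fixpoint sumR (n : nat) (f : nat -> R) : R :=
  match n with O => 0 | S k => sumR k f + f k end.

(** Operators on C^d: matrices indexed by 0..d-1 (entries outside are ignored). *)
Definition Mat : Type := nat -> nat -> C.
Definition mmul (d : nat) (A B : Mat) : Mat :=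
  fun i j => sumC d (fun k => Cmul (A i k) (B k j)).
Definition trace (d : nat) (A : Mat) : C := sumC d (fun i => A i i).
Definition idmat : Mat := fun i j => if Nat.eqb i j then C1 else C0.

Definition hermitian (d : nat) (A : Mat) : Prop :=
  forall i j, (i < d)%nat -> (j < d)%nat -> A j i = Cconj (A i j).
Definition psd (d : nat) (A : Mat) : Prop :=
  hermitian d A /\
  forall v : nat -> C,
    0 <= Re (sumC d (fun i => sumC d (fun j => Cmul (Cconj (v i)) (Cmul (A i j) (v j))))).
Definition density (d : nat) (A : Mat) : Prop := psd d A /\ trace d A = C1.

Definition povm (d n : nat) (M : nat -> Mat) : Prop :=
  (forall x, (x < n)%nat -> psd d (M x)) /\
  forall i j, (i < d)%nat -> (j < d)%nat -> sumC n (fun x => M x i j) = idmat i j.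

(** tr[M rho] (real for PSD M, rho) *)
Definition prob (d : nat) (M rho : Mat) : R := Re (trace d (mmul d M rho)).

Definition vnorm2 (d : nat) (v : nat -> C) : R :=
  Re (sumC d (fun i => Cmul (Cconj (v i)) (v i))).
Definition rank_one_proj (d : nat) (P : Mat) : Prop :=
  exists v : nat -> C, vnorm2 d v = 1 /\
    forall i j, (i < d)%nat -> (j < d)%nat -> P i j = Cmul (v i) (Cconj (v j)).
Definition proj_family (d : nat) (Ps : nat -> Mat) : Prop :=
  (forall k, (k < d)%nat -> rank_one_proj d (Ps k)) /\
  forall k l, (k < d)%nat -> (l < d)%nat -> k <> l ->
    forall i j, (i < d)%nat -> (j < d)%nat -> mmul d (Ps k) (Ps l) i j = C0.

Inductive ereal : Type := EFin (r : R) | EInf.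
Definition ele (x y : ereal) : Prop :=
  match x, y with
  | _, EInf => True
  | EInf, EFin _ => False
  | EFin a, EFin b => a <= b
  end.
Definition is_esup (S : ereal -> Prop) (v : ereal) : Prop :=
  (forall x, S x -> ele x v) /\ (forall u, (forall x, S x -> ele x u) -> ele v u).

Definition kl_term (p q : R) : R :=
  if Req_EM_T p 0 then 0 else p * ln (p / q).
Fixpoint kl_inf (n : nat) (P Q : nat -> R) : bool :=
  match n with
  | O => false
  | S k => kl_inf k P Q ||
           (if Req_EM_T (P k) 0 then false
            else if Req_EM_T (Q k) 0 then true else false)
  end.
Definition KL (n : nat) (P Q : nat -> R) : ereal :=
  if kl_inf n P Q then EInf else EFin (sumR n (fun x => kl_term (P x) (Q x))).

(** Values whose supremum is D^M(rho||sigma): over all finite sets (WLOG {0..n-1}) and POVMs *)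
Definition DM_set (d : nat) (rho sigma : Mat) (v : ereal) : Prop :=
  exists (n : nat) (M : nat -> Mat), povm d n M /\
    v = KL n (fun x => prob d (M x) rho) (fun x => prob d (M x) sigma).
(** Values whose supremum is D^P(rho||sigma) *)
Definition DP_set (d : nat) (rho sigma : Mat) (v : ereal) : Prop :=
  exists Ps : nat -> Mat, proj_family d Ps /\
    v = KL d (fun i => prob d (Ps i) rho) (fun i => prob d (Ps i) sigma).

(* Main.v *)
(** A POVM [M] whose outcome distributions are [P] (under [rho]) and [Q] (under
    [sigma]) is beaten, up to [eps], by the projective measurement in an eigenbasis of
    [omega = sum_x l x * M x], where [l = P / Q] (and [l = eps] where [P = 0]).
    Writing [omega = sum_k m k * P_k], operator convexity of the inverse gives
    [sum_k tr(P_k rho) / (m k + s) <= sum_x P x / (l x + s)] for all [s >= 0].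
    Integrating over [s] yields the operator Jensen inequality
    [sum_x P x ln (l x) <= sum_k tr(P_k rho) ln (m k)], and [ln t <= t - 1] bounds the
    right-hand side by the projective divergence plus [tr(omega sigma) - 1].
    If the divergence for [M] is infinite because of an outcome [x], then measuring in
    an eigenbasis of [M x] already gives an infinite divergence. *)

Require Import Defs.
From Stdlib Require Import Reals Lra Lia.

(** * Finite real sums *)

Lemma sumR_ext n f g :
  (forall x, (x < n)%nat -> f x = g x) -> sumR n f = sumR n g.
Proof.
induction n as [|n IH]; intros H; simpl; [reflexivity|].
rewrite IH, H by auto. reflexivity.
Qed.

Lemma sumR_le n f g :
  (forall x, (x < n)%nat -> f x <= g x) -> sumR n f <= sumR n g.
Proof.
induction n as [|n IH]; intros H; simpl; [lra|].
apply Rplus_le_compat; auto.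
Qed.

Lemma sumR_plus n f g : sumR n (fun x => f x + g x) = sumR n f + sumR n g.
Proof. induction n as [|n IH]; simpl; [|rewrite IH]; lra. Qed.

Lemma sumR_scal n c f : sumR n (fun x => c * f x) = c * sumR n f.
Proof. induction n as [|n IH]; simpl; [|rewrite IH]; lra. Qed.

Lemma sumR_minus n f g : sumR n (fun x => f x - g x) = sumR n f - sumR n g.
Proof. induction n as [|n IH]; simpl; [|rewrite IH]; lra. Qed.

Lemma sumR_ge0 n f : (forall x, (x < n)%nat -> 0 <= f x) -> 0 <= sumR n f.
Proof.
intros H. replace 0 with (sumR n (fun _ => 0)); [now apply sumR_le|].
clear H; induction n as [|n IH]; simpl; lra.
Qed.

Lemma sumR_ge_term n f k :
  (forall x, (x < n)%nat -> 0 <= f x) -> (k < n)%nat -> f k <= sumR n f.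
Proof.
induction n as [|n IH]; intros H Hk; simpl; [lia|].
assert (0 <= f n) by auto.
destruct (Nat.eq_dec k n) as [->|ne].
- assert (0 <= sumR n f) by auto using sumR_ge0. lra.
- assert (f k <= sumR n f) by (apply IH; [auto|lia]). lra.
Qed.

Lemma sumR_gt0_exists n f :
  0 < sumR n f -> exists2 k, (k < n)%nat & 0 < f k.
Proof.
induction n as [|n IH]; simpl; intros H; [lra|].
destruct (Rlt_le_dec 0 (f n)); [now exists n; [lia|]|].
destruct IH as [k Hk]; [lra|]. now exists k; [lia|].
Qed.

(** * Means of logarithms *)

Lemma ln_le_minus1 t : 0 < t -> ln t <= t - 1.
Proof.
intros H. generalize (exp_ineq1_le (ln t)). rewrite exp_ln by assumption. lra.
Qed.

Lemma derivable_pt_lim_sum_ln n p l s :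
  (forall x, (x < n)%nat -> 0 < l x) -> 0 <= s ->
  derivable_pt_lim (fun s => sumR n (fun x => p x * ln (l x + s))) s
    (sumR n (fun x => p x / (l x + s))).
Proof.
intros Hl Hs; induction n as [|n IH]; simpl.
- apply derivable_pt_lim_const.
- apply (derivable_pt_lim_plus
    (fun s => sumR n (fun x => p x * ln (l x + s))) (fun s => p n * ln (l n + s))).
  { apply IH; auto. }
  assert (0 < l n) by auto.
  apply (derivable_pt_lim_scal (fun s => ln (l n + s))).
  rewrite <- (Rmult_1_r (/ _)).
  apply (derivable_pt_lim_comp (fun s => l n + s) ln).
  + rewrite <- (Rplus_0_l 1).
    apply (derivable_pt_lim_plus (fun _ => l n) id).
    * apply derivable_pt_lim_const.
    * apply derivable_pt_lim_id.
  + apply derivable_pt_lim_ln; lra.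
Qed.

(* The difference of the two sides with [l + s], [m + s] in place of [l], [m] is
   monotone in [s >= 0] by hypothesis, and vanishes as [s] tends to infinity. *)
Lemma ln_mean_le n d p q l m :
  (forall x, (x < n)%nat -> 0 <= p x) -> sumR n p = 1 ->
  (forall k, (k < d)%nat -> 0 <= q k) -> sumR d q = 1 ->
  (forall x, (x < n)%nat -> 0 < l x) -> (forall k, (k < d)%nat -> 0 < m k) ->
  (forall s, 0 <= s ->
     sumR d (fun k => q k / (m k + s)) <= sumR n (fun x => p x / (l x + s))) ->
  sumR n (fun x => p x * ln (l x)) <= sumR d (fun k => q k * ln (m k)).
Proof.
intros Hp p1 Hq q1 Hl Hm H.
set (F := fun s => sumR n (fun x => p x * ln (l x + s))
                   - sumR d (fun k => q k * ln (m k + s))).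
set (K := sumR n (fun x => p x * l x)).
assert (HK : 0 <= K).
{ apply sumR_ge0; intros x Hx; specialize (Hp x Hx); specialize (Hl x Hx); nra. }
assert (F0 : F 0 = sumR n (fun x => p x * ln (l x)) - sumR d (fun k => q k * ln (m k))).
{ unfold F; f_equal; apply sumR_ext; intros; now rewrite Rplus_0_r. }
assert (HF : forall s, 0 < s -> F 0 <= K / s).
{ intros s Hs. apply Rle_trans with (F s).
  - destruct (MVT_cor2 F (fun s => sumR n (fun x => p x / (l x + s))
                - sumR d (fun k => q k / (m k + s))) 0 s Hs) as [c [E Hc]].
    { intros c Hc. apply derivable_pt_lim_minus;
        apply derivable_pt_lim_sum_ln; auto; lra. }
    assert (sumR d (fun k => q k / (m k + c)) <= sumR n (fun x => p x / (l x + c)))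
      by (apply H; lra).
    nra.
  (* Since [p] and [q] both have total 1, the two bounds share the term [ln s], which cancels in
     [F s] and leaves [K / s]. *)
  - assert (L1 : sumR n (fun x => p x * ln (l x + s)) <= ln s + K / s).
    { replace (ln s + K / s)
        with (sumR n (fun x => ln s * p x + / s * (p x * l x))).
      - apply sumR_le; intros x Hx. specialize (Hp x Hx); specialize (Hl x Hx).
        replace (l x + s) with (s * (1 + l x / s)) by (field; lra).
        assert (0 < l x / s) by now apply Rdiv_lt_0_compat.
        rewrite ln_mult by lra.
        assert (ln (1 + l x / s) <= l x / s).
        { generalize (ln_le_minus1 (1 + l x / s)); lra. }
        replace (ln s * p x + / s * (p x * l x)) with (p x * (ln s + l x / s))
          by (field; lra).
        apply Rmult_le_compat_l; lra.
      - rewrite sumR_plus, !sumR_scal, p1. fold K. field; lra. }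
    assert (L2 : ln s <= sumR d (fun k => q k * ln (m k + s))).
    { replace (ln s) with (sumR d (fun k => ln s * q k))
        by (rewrite sumR_scal, q1; ring).
      apply sumR_le; intros k Hk. specialize (Hq k Hk); specialize (Hm k Hk).
      assert (ln s < ln (m k + s)) by (apply ln_increasing; lra). nra. }
    unfold F; lra. }
enough (F 0 <= 0) by lra.
apply Rnot_lt_le; intros F0pos.
(* The choice [s = (K + 1) / F 0] turns [K / s] into [F 0 * (K / (K + 1))]; the added 1 keeps [s]
   positive even when [K = 0]. *)
assert (E : K / ((K + 1) / F 0) < F 0).
{ replace (K / ((K + 1) / F 0)) with (F 0 * (K / (K + 1))) by (field; lra).
  assert (K / (K + 1) < 1).
  { apply Rmult_lt_reg_r with (K + 1); [lra|].
    replace (K / (K + 1) * (K + 1)) with K by (field; lra). lra. }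
  nra. }
assert (F 0 <= K / ((K + 1) / F 0)).
{ apply HF, Rdiv_lt_0_compat; lra. }
lra.
Qed.

(** * Classical divergence, likelihood ratios and extended suprema *)

Lemma kl_inf_true n P Q :
  kl_inf n P Q = true <-> exists x, (x < n)%nat /\ P x <> 0 /\ Q x = 0.
Proof.
induction n as [|n IH]; simpl.
- split; [discriminate|]. intros [x [Hx _]]; lia.
- rewrite Bool.orb_true_iff, IH. split.
  + intros [[x [Hx HPQ]]|H]; [exists x; split; [lia|exact HPQ]|].
    exists n; split; [lia|]. destruct (Req_EM_T (P n) 0); [discriminate|].
    destruct (Req_EM_T (Q n) 0); [auto|discriminate].
  + intros [x [Hx [HP HQ]]]. destruct (Nat.eq_dec x n) as [->|ne].
    * right. destruct (Req_EM_T (P n) 0); [contradiction|].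
      destruct (Req_EM_T (Q n) 0); [auto|contradiction].
    * left. exists x. split; [lia|auto].
Qed.

Lemma kl_inf_false n P Q x :
  kl_inf n P Q = false -> (x < n)%nat -> P x <> 0 -> Q x <> 0.
Proof.
intros H Hx HP HQ. enough (kl_inf n P Q = true) by congruence.
apply kl_inf_true; eauto.
Qed.

(** Termwise this is [ln t <= t - 1] at [t = m x * q x / p x], multiplied by [p x]; where [p x = 0]
    only [0 <= m x * q x] remains. *)
Lemma KL_variational_le n p q m :
  (forall x, (x < n)%nat -> 0 <= p x) -> (forall x, (x < n)%nat -> 0 <= q x) ->
  (forall x, (x < n)%nat -> 0 < m x) -> kl_inf n p q = false ->
  sumR n (fun x => p x * ln (m x)) <=
  sumR n (fun x => kl_term (p x) (q x)) + sumR n (fun x => m x * q x) - sumR n p.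
Proof.
intros Hp Hq Hm Hfin. rewrite <- sumR_plus, <- sumR_minus.
apply sumR_le; intros x Hx.
generalize (kl_inf_false n p q x Hfin Hx).
specialize (Hp x Hx); specialize (Hq x Hx); specialize (Hm x Hx).
unfold kl_term; destruct (Req_EM_T (p x) 0) as [->|Px]; intros Qx; [nra|].
specialize (Qx Px).
assert (0 < p x / q x) by (apply Rdiv_lt_0_compat; lra).
assert (L : ln (m x) - ln (p x / q x) <= m x * q x / p x - 1).
{ assert (pos : 0 < m x * q x / p x).
  { apply Rdiv_lt_0_compat; [apply Rmult_lt_0_compat|]; lra. }
  replace (m x) with (p x / q x * (m x * q x / p x)) at 1 by (field; lra).
  rewrite ln_mult by assumption.
  generalize (ln_le_minus1 _ pos); lra. }
apply Rmult_le_compat_l with (r := p x) in L; [|lra].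
replace (p x * (m x * q x / p x - 1)) with (m x * q x - p x) in L by (field; lra).
lra.
Qed.

(** The value [eps] off the support keeps every weight positive, so that logarithms and inverses of
    the weights make sense. *)
Definition likelihood_ratio (eps p q : R) : R :=
  if Req_EM_T p 0 then eps else p / q.

Lemma likelihood_ratio_gt0 eps p q :
  0 < eps -> 0 <= p -> 0 <= q -> (p <> 0 -> q <> 0) ->
  0 < likelihood_ratio eps p q.
Proof.
intros Heps Hp Hq Hpq. unfold likelihood_ratio.
destruct (Req_EM_T p 0) as [|np]; [assumption|].
specialize (Hpq np). apply Rdiv_lt_0_compat; lra.
Qed.

Lemma kl_term_likelihood_ratio eps p q :
  kl_term p q = p * ln (likelihood_ratio eps p q).
Proof.
unfold kl_term, likelihood_ratio.
destruct (Req_EM_T p 0) as [->|]; [ring|reflexivity].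
Qed.

(** Summed over the outcomes of a POVM, this bounds tr(omega sigma) by tr(rho) + [eps] tr(sigma). *)
Lemma likelihood_ratio_mult_le eps p q :
  0 <= eps -> 0 <= q -> (p <> 0 -> q <> 0) ->
  likelihood_ratio eps p q * q <= p + eps * q.
Proof.
intros Heps Hq Hpq. unfold likelihood_ratio.
destruct (Req_EM_T p 0) as [->|np]; [lra|].
specialize (Hpq np).
replace (p / q * q) with p by (field; assumption). nra.
Qed.

(** Either some finite bound exists and completeness of the reals applies, or [EInf] is the only
    upper bound. The member [x0] matters because [ereal] has no least element to serve the empty
    set. *)
Lemma esup_exists (S : ereal -> Prop) x0 : S x0 -> exists v, is_esup S v.
Proof.
intros Sx0.
destruct (Classical_Prop.classic (exists r, forall x, S x -> ele x (EFin r)))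
  as [[r Hr]|unb].
- assert (HE : {m | is_lub (fun a => S (EFin a)) m}).
  { apply completeness.
    - exists r; intros a Sa. exact (Hr _ Sa).
    - destruct x0 as [a|]; [exists a; exact Sx0|destruct (Hr _ Sx0)]. }
  destruct HE as [m [ub least]]. exists (EFin m). split.
  + intros [a|] Sa; [exact (ub a Sa)|destruct (Hr _ Sa)].
  + intros [u|] Hu; simpl; [|exact I]. apply least. intros a Sa. exact (Hu _ Sa).
- exists EInf. split.
  + intros [a|] _; exact I.
  + intros [u|] Hu; simpl; [|exact I]. apply unb. exists u. exact Hu.
Qed.

From mathcomp Require Import all_boot all_order all_algebra.
From mathcomp Require Import spectral sesquilinear complex Rstruct.
Set Implicit Arguments.
Unset Strict Implicit.
Unset Printing Implicit Defensive.
Import Order.TTheory GRing.Theory Num.Theory.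
Local Open Scope ring_scope.
Local Open Scope sesquilinear_scope.

(** * Gram matrices, spectral projectors and the operator inequality for inverses *)

Section Gram.
Variables (C : numClosedFieldType) (d : nat).
Implicit Types X Y Z A B U : 'M[C]_d.

(** Positive semidefiniteness as a factorization, which makes congruence and trace positivity purely
    algebraic. The free height [m] lets a single row witness a rank-one projector. *)
Definition gram X := exists m (Y : 'M_(m, d)), X = Y^t* *m Y.

Lemma trmxC_mul m n p (A : 'M[C]_(m, n)) (B : 'M_(n, p)) :
  (A *m B)^t* = B^t* *m A^t*.
Proof. by rewrite trmx_mul map_mxM. Qed.

Lemma gram_conj X : gram X -> X^t* = X.
Proof. by case=> m [Y ->]; rewrite trmxC_mul trmxCK. Qed.

Lemma gram_congr X B : gram X -> gram (B^t* *m X *m B).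
Proof. by case=> m [Y ->]; exists m, (Y *m B); rewrite trmxC_mul !mulmxA. Qed.

(** With [X = A^t* *m A] and [Y = B^t* *m B], cyclicity makes the trace the sum of the squared
    moduli of the entries of [A *m B^t*]. *)
Lemma mxtrace_gram_ge0 X Y : gram X -> gram Y -> 0 <= \tr (X *m Y).
Proof.
case=> m [A ->] [p [B ->]].
rewrite -mulmxA mxtrace_mulC -!mulmxA (mulmxA A).
rewrite -[B in X in A *m B^t* *m X]trmxCK -trmxC_mul.
apply: sumr_ge0 => i _; rewrite mxE; apply: sumr_ge0 => j _.
by rewrite !mxE mul_conjC_ge0.
Qed.

Lemma mxtrace_scale_suml n (a : 'I_n -> C) (M : 'I_n -> 'M[C]_d) X :
  \tr ((\sum_x a x *: M x) *m X) = \sum_x a x * \tr (M x *m X).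
Proof.
rewrite mulmx_suml raddf_sum; apply: eq_bigr => x _ /=.
by rewrite -scalemxAl mxtraceZ.
Qed.

(** Row [k] is read as a bra, so for unitary [U] this is the projector onto the ket
    [(row k U)^t*]. *)
Definition row_proj U k : 'M[C]_d := (row k U)^t* *m row k U.

Lemma row_projE U k i j : row_proj U k i j = (U k i)^* * U k j.
Proof. by rewrite mxE big_ord1 !mxE. Qed.

Lemma scalemx_row_projE (c : C) U k i j :
  (c *: row_proj U k) i j = c * ((U k i)^* * U k j).
Proof. by rewrite [LHS]mxE row_projE. Qed.

Lemma sum_row_proj U (a : 'I_d -> C) :
  \sum_k a k *: row_proj U k = U^t* *m diag_mx (\row_k a k) *m U.
Proof.
apply/matrixP=> i j; rewrite summxE mul_mx_diag mxE; apply: eq_bigr => k _.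
by rewrite scalemx_row_projE !mxE mulrA [a k * _]mulrC.
Qed.

Lemma gram_row_proj U k : gram (row_proj U k).
Proof. by exists 1, (row k U). Qed.

Lemma mxtrace_row_proj U X k : \tr (row_proj U k *m X) = (U *m X *m U^t*) k k.
Proof.
rewrite /row_proj -[in LHS]mulmxA mxtrace_mulC -row_mul trace_mx11 !mxE.
by apply: eq_bigr => i _; rewrite !mxE.
Qed.

Lemma mxtrace_row_proj1 U k : U \is unitarymx -> \tr (row_proj U k) = 1.
Proof.
move=> /unitarymxP UU; rewrite -[row_proj U k]mulmx1 mxtrace_row_proj.
by rewrite mulmx1 UU mxE eqxx.
Qed.

Lemma spectral_row_proj A : A^t* = A ->
  exists2 U, U \is unitarymx & exists2 a : 'I_d -> C,
    (forall k, a k \is Num.real) & A = \sum_k a k *: row_proj U k.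
Proof.
move=> EhA; have hA : A \is hermsymmx.
  by apply/is_hermitianmxP; rewrite expr0 scale1r EhA.
have /orthomx_spectralP EA := hermitian_normalmx hA.
exists (spectralmx A); first exact: spectral_unitarymx.
exists (fun k => spectral_diag A 0 k).
  by move=> k; have /mxOverP := hermitian_spectral_diag_real hA; apply.
rewrite sum_row_proj {1}EA invmx_unitary ?spectral_unitarymx //.
by congr (_ *m diag_mx _ *m _); apply/rowP=> k; rewrite mxE.
Qed.

Lemma mxtrace_sum_row_proj U (a : 'I_d -> C) k : U \is unitarymx ->
  \tr ((\sum_l a l *: row_proj U l) *m row_proj U k) = a k.
Proof.
move=> /unitarymxP UU; rewrite mxtrace_mulC mxtrace_row_proj sum_row_proj.
rewrite !mulmxA UU mul1mx -mulmxA UU mulmx1 mxE mxE.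
by rewrite eqxx.
Qed.

(** In an eigenbasis the diagonal entries are the eigenvalues, whose square roots give the Gram
    factor. Nonnegativity is asked only of real entries because [psd] constrains only the real part
    of the quadratic form. *)
Lemma gramP A : A^t* = A ->
  (forall k U, U \is unitarymx -> (U *m A *m U^t*) k k \is Num.real ->
     0 <= (U *m A *m U^t*) k k) -> gram A.
Proof.
move=> hA A0; have [U uU [a ra EA]] := spectral_row_proj hA.
have a0 k : 0 <= a k.
  have E : (U *m A *m U^t*) k k = a k.
    by rewrite -mxtrace_row_proj mxtrace_mulC {1}EA mxtrace_sum_row_proj.
  by rewrite -E A0 // E.
exists d, (diag_mx (\row_k sqrtC (a k)) *m U).
rewrite EA sum_row_proj trmxC_mul -!mulmxA; congr (_ *m _).
rewrite !mulmxA; congr (_ *m _).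
rewrite tr_diag_mx map_diag_mx mulmx_diag; congr diag_mx.
apply/rowP=> k; rewrite !mxE /= geC0_conj ?sqrtC_ge0 //.
by rewrite -expr2 sqrtCK.
Qed.

(* With [w = B v], this is the sum over [x] of
   [<v / sqrt (a x) - sqrt (a x) w, M x (v / sqrt (a x) - sqrt (a x) w)> >= 0]. *)
Lemma mxtrace_inv_le n (M : 'I_n -> 'M[C]_d) (a : 'I_n -> C) B X :
  (forall x, gram (M x)) -> \sum_x M x = 1%:M -> (forall x, 0 < a x) ->
  B^t* = B -> B *m (\sum_x a x *: M x) = 1%:M -> gram X ->
  \tr (B *m X) <= \sum_x (a x)^-1 * \tr (M x *m X).
Proof.
move=> M0 M1 a0 hB Binv X0.
pose T x := (1%:M - a x *: B) *m M x *m (1%:M - a x *: B).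
have T0 x : gram (T x).
  have -> : T x = (1%:M - a x *: B)^t* *m M x *m (1%:M - a x *: B).
    congr (_ *m _ *m _); apply/matrixP=> i j; rewrite -{1}hB !mxE rmorphB rmorphM /=.
    by rewrite rmorph_nat (CrealP (gtr0_real (a0 x))) eq_sym.
  exact: gram_congr.
have ET x : (a x)^-1 *: T x =
    (a x)^-1 *: M x - B *m M x - M x *m B + B *m (a x *: M x) *m B.
  have ax : a x != 0 by rewrite gt_eqF.
  rewrite /T mulmxBl mul1mx mulmxBr mulmx1 mulmxBl -?(scalemxAr, scalemxAl).
  by rewrite !scalerBr !scalerA mulVf // mul1r !scale1r opprB addrA addrAC.
(* Each cross term sums to [- B] as the [M x] sum to 1, and the quadratic term sums to [B] as [B]
   inverts the weighted sum. *)
have E : \sum_x (a x)^-1 *: T x = \sum_x (a x)^-1 *: M x - B.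
  rewrite (eq_bigr _ (fun x _ => ET x)) big_split /= !sumrB.
  rewrite -!mulmx_suml -!mulmx_sumr M1 Binv mulmx1 !mul1mx.
  by rewrite subrK.
rewrite -subr_ge0.
have -> : \sum_x (a x)^-1 * \tr (M x *m X) - \tr (B *m X) =
    \sum_x (a x)^-1 * \tr (T x *m X).
  by rewrite -[RHS]mxtrace_scale_suml E mulmxBl [RHS]raddfB /= mxtrace_scale_suml.
apply: sumr_ge0 => x _; apply: mulr_ge0; first by rewrite invr_ge0 ltW.
exact: mxtrace_gram_ge0.
Qed.

(** As the [M x] sum to 1, replacing [a x] by [a x + s] adds [s] times the identity to the weighted
    sum. The eigenbasis is unchanged, so one [U] serves all [s]. *)
Lemma povm_spectral n (M : 'I_n -> 'M[C]_d) (a : 'I_n -> C) :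
  (forall x, gram (M x)) -> \sum_x M x = 1%:M -> (forall x, 0 < a x) ->
  exists2 U, U \is unitarymx & exists b : 'I_d -> C,
    [/\ forall k, 0 < b k,
        \sum_x a x *: M x = \sum_k b k *: row_proj U k &
        forall (s : C) X, 0 <= s -> gram X ->
          \sum_k (b k + s)^-1 * \tr (row_proj U k *m X) <=
          \sum_x (a x + s)^-1 * \tr (M x *m X)].
Proof.
move=> M0 M1 a0.
have hA : (\sum_x a x *: M x)^t* = \sum_x a x *: M x.
  apply/matrixP=> i j; rewrite !mxE !summxE rmorph_sum; apply: eq_bigr => x _.
  rewrite -{2}(gram_conj (M0 x)) !mxE rmorphM /=.
  by rewrite (CrealP (gtr0_real (a0 x))).
have [U uU [b rb EA]] := spectral_row_proj hA.
(* The eigenvalue [b k] is an average of the positive [a x] with weights tr(M x P_k), which are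
   nonnegative and sum to 1. *)
have b0 k : 0 < b k.
  have Eb : b k = \sum_x a x * \tr (M x *m row_proj U k).
    by rewrite -[LHS](mxtrace_sum_row_proj b k uU) -EA mxtrace_scale_suml.
  have t0 x : 0 <= \tr (M x *m row_proj U k).
    exact: mxtrace_gram_ge0 (M0 x) (gram_row_proj U k).
  have t1 : \sum_x \tr (M x *m row_proj U k) = 1.
    rewrite -(mxtrace_row_proj1 k uU) -[in RHS](mul1mx (row_proj U k)) -M1.
    by rewrite mulmx_suml raddf_sum.
  rewrite lt0r Eb sumr_ge0 ?andbT; last by move=> x _; rewrite mulr_ge0 // ltW.
  apply/negP; rewrite psumr_eq0 => [/allP t|x _]; last by rewrite mulr_ge0 // ltW.
  have := oner_neq0 C; rewrite -t1 big1 ?eqxx // => x _.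
  by apply/eqP; have := t x (mem_index_enum x); rewrite mulf_eq0 gt_eqF.
exists U => //; exists b; split => // s X s0 X0.
(* The inverse of the shifted weighted sum, written in its eigenbasis. *)
pose B := \sum_k (b k + s)^-1 *: row_proj U k.
have UU : U *m U^t* = 1%:M by apply/unitarymxP.
have UU' : U^t* *m U = 1%:M by apply: mulmx1C.
have bs k : 0 < b k + s by rewrite ltr_wpDr.
rewrite -mxtrace_scale_suml -/B.
apply: mxtrace_inv_le => // [x||].
- by rewrite ltr_wpDr.
- rewrite /B sum_row_proj !trmxC_mul trmxCK mulmxA; congr (_ *m _ *m _).
  rewrite tr_diag_mx map_diag_mx; congr diag_mx; apply/rowP=> k; rewrite !mxE.
  by rewrite /= (CrealP _) // gtr0_real // invr_gt0.
have -> : \sum_x (a x + s) *: M x = \sum_k (b k + s) *: row_proj U k.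
  under eq_bigr do rewrite scalerDl; under [RHS]eq_bigr do rewrite scalerDl.
  rewrite !big_split /= EA; congr (_ + _).
  rewrite -scaler_sumr M1 sum_row_proj.
  have -> : diag_mx (\row__ s) = s%:M :> 'M_d.
    by rewrite -diag_const_mx; congr diag_mx; apply/rowP=> k; rewrite !mxE.
  by rewrite mul_mx_scalar -scalemxAl UU'.
rewrite /B !sum_row_proj !mulmxA -[_ *m U *m U^t*]mulmxA UU mulmx1.
rewrite -[_ *m diag_mx _ *m diag_mx _]mulmxA mulmx_diag.
have -> : diag_mx (\row_k ((\row_k (b k + s)^-1) 0 k * (\row_k (b k + s)) 0 k))
  = 1%:M :> 'M[C]_d.
  rewrite -diag_const_mx; congr diag_mx; apply/rowP=> k; rewrite !mxE mulVf //.
  by rewrite gt_eqF.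
by rewrite mulmx1.
Qed.

End Gram.

(** * Transfer to matrices over [RC] *)

Notation RC := (complex Rdefinitions.R).
Notation toRC := (real_complex Rdefinitions.R).

Definition toC (z : Defs.C) : RC := Complex z.1 z.2.
Definition ofC (z : RC) : Defs.C := (complex.Re z, complex.Im z).

Lemma toCK : cancel toC ofC. Proof. by case. Qed.
Lemma ofCK : cancel ofC toC. Proof. by case. Qed.

Lemma toC_conj z : toC (Cconj z) = (toC z)^*. Proof. by []. Qed.

Lemma toC_mul z w : toC (Cmul z w) = toC z * toC w.
Proof. by []. Qed.

Lemma toC_sum n f : toC (sumC n f) = \sum_(i < n) toC (f i).
Proof. by elim: n => [|n IH]; rewrite ?big_ord0 // big_ord_recr -IH. Qed.

Lemma toC_Re z : 0 <= toC z -> toC z = toRC (Defs.Re z).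
Proof. by case: z => a b /ger0_Im /= ->. Qed.

Lemma sumR_sum n f : sumR n f = \sum_(i < n) f i.
Proof. by elim: n => [|n IH]; rewrite ?big_ord0 // big_ord_recr -IH. Qed.

Lemma toRC_sumR n f : toRC (sumR n f) = \sum_(i < n) toRC (f i).
Proof. by rewrite sumR_sum rmorph_sum. Qed.

Definition toM d (A : Mat) : 'M[RC]_d := \matrix_(i, j) toC (A i j).

Lemma toM_mul d A B : toM d (mmul d A B) = toM d A *m toM d B.
Proof.
apply/matrixP=> i j; rewrite !mxE toC_sum; apply: eq_bigr => k _.
by rewrite !mxE toC_mul.
Qed.

Lemma toM_eq d A B :
  (forall i j, (i < d)%coq_nat -> (j < d)%coq_nat -> A i j = B i j) <->
  toM d A = toM d B.
Proof.
split=> [E|/matrixP E i j /ssrnat.ltP id /ssrnat.ltP jd].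
  by apply/matrixP=> i j; rewrite !mxE E //; apply/ssrnat.ltP.
by have := E (Ordinal id) (Ordinal jd); rewrite !mxE => /(can_inj toCK).
Qed.

Lemma toC_trace d A : toC (trace d A) = \tr (toM d A).
Proof. by rewrite toC_sum; apply: eq_bigr => i _; rewrite mxE. Qed.

Lemma toM_idmat d : toM d idmat = 1%:M.
Proof.
apply/matrixP=> i j; rewrite !mxE /idmat -val_eqE /=.
by case: (PeanoNat.Nat.eqb_spec i j) => [->|/eqP/negPf ->]; rewrite ?eqxx.
Qed.

Lemma toM_sum d n (M : nat -> Mat) :
  toM d (fun i j => sumC n (fun x => M x i j)) = \sum_(x < n) toM d (M x).
Proof.
apply/matrixP=> i j; rewrite summxE mxE toC_sum.
by apply: eq_bigr => x _; rewrite mxE.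
Qed.

Lemma hermitianP d A : Defs.hermitian d A <-> (toM d A)^t* = toM d A.
Proof.
split=> [hA|/matrixP hA i j /ssrnat.ltP id /ssrnat.ltP jd].
  by apply/matrixP=> i j; rewrite !mxE (hA j i) //; apply/ssrnat.ltP.
have := hA (Ordinal jd) (Ordinal id).
by rewrite !mxE -toC_conj => /(can_inj toCK) ->.
Qed.

Definition outer (v : nat -> Defs.C) : Mat := fun i j => Cmul (v i) (Cconj (v j)).

Definition bra d (v : nat -> Defs.C) : 'rV[RC]_d := \row_j (toC (v j))^*.

Lemma toM_outer d v : toM d (outer v) = (bra d v)^t* *m bra d v.
Proof. by apply/matrixP=> i j; rewrite !mxE big_ord1 !mxE conjCK. Qed.

Lemma bra_norm d v : toC (sumC d (fun i => Cmul (Cconj (v i)) (v i))) =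
  (bra d v *m (bra d v)^t*) 0 0.
Proof.
by rewrite mxE toC_sum; apply: eq_bigr => i _; rewrite !mxE conjCK.
Qed.

Definition qform d (A : Mat) (v : nat -> Defs.C) : Defs.C :=
  sumC d (fun i => sumC d (fun j => Cmul (Cconj (v i)) (Cmul (A i j) (v j)))).

(** Turns quadratic forms into traces, to which [mxtrace_gram_ge0] and [mxtrace_row_proj] apply. *)
Lemma toC_qform d A v : toC (qform d A v) = \tr (toM d A *m toM d (outer v)).
Proof.
rewrite toC_sum; apply: eq_bigr => i _; rewrite mxE toC_sum.
apply: eq_bigr => j _; rewrite !mxE !toC_mul toC_conj.
by rewrite mulrC -mulrA.
Qed.

(* The rows of a unitary [U] are the bras of an orthonormal basis; [vec U k] is the
   [k]-th ket. *)
Definition vec d (U : 'M[RC]_d) (k i : nat) : Defs.C :=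
  if (insub k, insub i) is (Some k', Some i') then ofC (U k' i')^* else C0.

Lemma bra_vec d (U : 'M[RC]_d) (k : 'I_d) : bra d (vec U k) = row k U.
Proof. by apply/rowP=> i; rewrite !mxE /vec !valK ofCK conjCK. Qed.

Lemma toM_outer_vec d (U : 'M[RC]_d) (k : 'I_d) :
  toM d (outer (vec U k)) = row_proj U k.
Proof. by rewrite toM_outer bra_vec. Qed.

Lemma psdP d A : psd d A <-> gram (toM d A).
Proof.
split=> [[hA A0]|[m [Y EY]]].
  apply: gramP => [|k U uU]; first exact/hermitianP.
  rewrite -mxtrace_row_proj mxtrace_mulC -toM_outer_vec -toC_qform.
  move/complex_realP => [r Er]; rewrite Er ler0c.
  have -> : r = Defs.Re (qform d A (vec U k)) by move: Er; case: qform => a b [].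
  exact/RleP/A0.
split.
  by apply/hermitianP; rewrite EY trmxC_mul trmxCK.
move=> v; have : 0 <= toC (qform d A v).
  rewrite toC_qform mxtrace_gram_ge0 //; first by exists m, Y.
  by exists 1, (bra d v); rewrite toM_outer.
by move=> /[dup] /toC_Re ->; rewrite ler0c => /RleP.
Qed.

(** Taking the real part in [prob] loses nothing, since the trace of a product of two Gram matrices
    is real and nonnegative. *)
Lemma toRC_prob d A B : psd d A -> psd d B ->
  toRC (prob d A B) = \tr (toM d A *m toM d B).
Proof.
move=> /psdP A0 /psdP B0; rewrite -toM_mul -toC_trace -toC_Re //.
by rewrite toC_trace toM_mul mxtrace_gram_ge0.
Qed.

Lemma prob_ge0 d A B : psd d A -> psd d B -> Rle 0 (prob d A B).
Proof.
move=> A0 B0; apply/RleP; rewrite -ler0c toRC_prob //.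
by apply: mxtrace_gram_ge0; apply/psdP.
Qed.

Lemma sum_prob_povm d n M A : povm d n M -> psd d A ->
  sumR n (fun x => prob d (M x) A) = Defs.Re (trace d A).
Proof.
move=> [M0 M1] A0; apply: complexI; rewrite toRC_sumR.
have -> : toRC (Defs.Re (trace d A)) = \tr (toM d A).
  rewrite -toC_trace -toC_Re // toC_trace.
  rewrite -[toM d A]mul1mx; apply: mxtrace_gram_ge0; last exact/psdP.
  by exists d, 1%:M; rewrite trmx1 map_mx1 mulmx1.
have E1 : \sum_(x < n) toM d (M x) = 1%:M.
  by rewrite -toM_sum -toM_idmat; apply/toM_eq.
rewrite -[in RHS](mul1mx (toM d A)) -E1 mulmx_suml raddf_sum.
by apply: eq_bigr => x _; rewrite toRC_prob //; apply: M0; apply/ssrnat.ltP.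
Qed.

(** * Orthonormal bases and projective families *)

Lemma unitary_rowP d (U : 'M[RC]_d) : U \is unitarymx <->
  forall k l, row k U *m (row l U)^t* = (k == l)%:R%:M.
Proof.
have E k l : (row k U *m (row l U)^t*) 0 0 = (U *m U^t*) k l.
  by rewrite !mxE; apply: eq_bigr => i _; rewrite !mxE.
split=> [/unitarymxP UU k l|UU].
  by rewrite [LHS]mx11_scalar E UU mxE.
by apply/unitarymxP/matrixP=> k l; rewrite -E UU !mxE.
Qed.

Lemma proj_family_unitary d (U : 'M[RC]_d) :
  U \is unitarymx -> proj_family d (fun k => outer (vec U k)).
Proof.
move=> /unitary_rowP UU.
split=> [k /ssrnat.ltP kd|k l /ssrnat.ltP kd /ssrnat.ltP ld kl].
  exists (vec U k); split=> //.
  have := bra_norm d (vec U k); rewrite (bra_vec U (Ordinal kd)) UU eqxx.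
  by rewrite mxE eqxx mulr1n /vnorm2; case: sumC => a b [].
apply/(toM_eq d _ (fun _ _ => C0)).
rewrite toM_mul (toM_outer_vec U (Ordinal kd)) (toM_outer_vec U (Ordinal ld)).
rewrite /row_proj mulmxA -[_ *m row _ U *m _]mulmxA UU.
have -> : (Ordinal kd == Ordinal ld) = false by apply/eqP=> -[].
by rewrite raddf0 mulmx0 mul0mx; apply/matrixP=> i j; rewrite !mxE.
Qed.

Lemma unitary_proj_family d Ps : proj_family d Ps ->
  exists2 U : 'M[RC]_d, U \is unitarymx &
    forall k : 'I_d, toM d (Ps k) = row_proj U k.
Proof.
move=> [P1 P0].
have /fin_all_exists [v Hv] : forall k : 'I_d, exists v : nat -> Defs.C,
    vnorm2 d v = 1 /\ toM d (Ps k) = toM d (outer v).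
  move=> k; have [|v [v1 Ev]] := P1 k; first exact/ssrnat.ltP.
  by exists v; split=> //; apply/toM_eq.
pose U := \matrix_k bra d (v k).
have PU (k : 'I_d) : toM d (Ps k) = row_proj U k.
  by rewrite (proj2 (Hv k)) toM_outer /row_proj rowK.
have U1 k : row k U *m (row k U)^t* = 1%:M.
  have [v1 _] := Hv k; rewrite [LHS]mx11_scalar rowK -bra_norm toC_Re.
    by rewrite [Defs.Re _]v1.
  rewrite bra_norm mxE; apply: sumr_ge0 => i _.
  by rewrite !mxE mul_conjC_ge0.
exists U => //; apply/unitary_rowP => k l.
case: eqVneq => [-> //|kl].
have P0' : row_proj U k *m row_proj U l = 0.
  rewrite -!PU -toM_mul; transitivity (toM d (fun _ _ => C0)).
    apply/toM_eq; apply: P0; do ?[exact/ssrnat.ltP].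
    by move/val_inj/eqP; apply/negP.
  by apply/matrixP=> i j; rewrite !mxE.
(* Inserting the unit norms rewrites the inner product of rows [k] and [l] as the product of the two
   projectors, which is 0, between these rows. *)
rewrite -[LHS]mul1mx -(U1 k) -[LHS]mulmx1 -(U1 l).
transitivity (row k U *m (row_proj U k *m row_proj U l) *m (row l U)^t*).
  by rewrite /row_proj !mulmxA.
by rewrite P0' mulmx0 mul0mx raddf0.
Qed.

(** Completeness is a dimension count: for the square matrix [U] of bras, [U *m U^t* = 1] forces
    [U^t* *m U = 1]. *)
Lemma povm_proj_family d Ps : proj_family d Ps -> povm d d Ps.
Proof.
move=> /unitary_proj_family [U uU PU]; split=> [k /ssrnat.ltP kd|].
  by apply/psdP; rewrite (PU (Ordinal kd)); apply: gram_row_proj.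
apply/toM_eq; rewrite toM_sum toM_idmat.
rewrite (eq_bigr (fun k => 1 *: row_proj U k)) => [|k _]; last first.
  by rewrite scale1r PU.
rewrite sum_row_proj.
have -> : diag_mx (\row__ 1) = 1%:M :> 'M[RC]_d.
  by rewrite -diag_const_mx; congr diag_mx; apply/rowP=> k; rewrite !mxE.
by rewrite mulmx1; apply/mulmx1C/unitarymxP.
Qed.

(** * Comparing a POVM with a projective measurement *)

Definition Re_ext d (b : 'I_d -> RC) (k : nat) : Rdefinitions.R :=
  if insub k is Some k' then complex.Re (b k') else 0.

Lemma toRC_Re_ext d (b : 'I_d -> RC) k : b k \is Num.real -> toRC (Re_ext b k) = b k.
Proof. by move=> rb; rewrite /Re_ext valK RRe_real. Qed.

Lemma psd_outer d v : psd d (outer v).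
Proof. by apply/psdP; exists 1, (bra d v); rewrite toM_outer. Qed.

Lemma psd_spectral d A : psd d A -> exists Ps m,
  [/\ proj_family d Ps, forall k, (k < d)%coq_nat -> Rle 0 (m k) &
   forall X, psd d X -> prob d A X = sumR d (fun k => Rmult (m k) (prob d (Ps k) X))].
Proof.
move=> A0; have [/hermitianP hA _] := A0.
have [U uU [b rb EA]] := spectral_row_proj hA.
exists (fun k => outer (vec U k)), (Re_ext b); split.
- exact: proj_family_unitary.
- move=> k /ssrnat.ltP kd; apply/RleP; rewrite -ler0c.
  rewrite (toRC_Re_ext (k := Ordinal kd)) // -(mxtrace_sum_row_proj b _ uU) -EA.
  apply: mxtrace_gram_ge0 (gram_row_proj _ _); exact/psdP.
move=> X X0; apply: complexI; rewrite toRC_prob // EA mxtrace_scale_suml toRC_sumR.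
apply: eq_bigr => k _; rewrite rmorphM /= toRC_Re_ext // toRC_prob ?toM_outer_vec //.
exact: psd_outer.
Qed.

(** The trace identity is meant for [X = sigma], where it evaluates tr(omega sigma); the resolvent
    inequality is meant for [X = rho], where it feeds [ln_mean_le]. *)
Lemma povm_projective_compare d n M l : povm d n M ->
  (forall x, (x < n)%coq_nat -> Rlt 0 (l x)) -> exists Ps m,
  [/\ proj_family d Ps, forall k, (k < d)%coq_nat -> Rlt 0 (m k),
   forall X, psd d X -> sumR d (fun k => Rmult (m k) (prob d (Ps k) X)) =
     sumR n (fun x => Rmult (l x) (prob d (M x) X)) &
   forall X s, psd d X -> Rle 0 s ->
     Rle (sumR d (fun k => Rdiv (prob d (Ps k) X) (Rplus (m k) s)))
         (sumR n (fun x => Rdiv (prob d (M x) X) (Rplus (l x) s)))].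
Proof.
move=> [M0 M1] l0.
have psdM (x : 'I_n) : psd d (M x) by apply: M0; apply/ssrnat.ltP.
have [|||U uU [b [b0 Eb Hb]]] :=
  @povm_spectral RC d n (fun x => toM d (M x)) (fun x => toRC (l x)).
- by move=> x; apply/psdP.
- by rewrite -toM_sum -toM_idmat; apply/toM_eq.
- by move=> x; rewrite ltcR; apply/RltP/l0/ssrnat.ltP.
have Emk (k : 'I_d) : toRC (Re_ext b k) = b k by rewrite toRC_Re_ext // gtr0_real.
exists (fun k => outer (vec U k)), (Re_ext b); split.
- exact: proj_family_unitary.
- by move=> k /ssrnat.ltP kd; apply/RltP; rewrite -ltcR (Emk (Ordinal kd)).
- move=> X X0; apply: complexI; rewrite !toRC_sumR.
  transitivity (\tr ((\sum_k b k *: row_proj U k) *m toM d X)); last first.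
    rewrite -Eb mxtrace_scale_suml; apply: eq_bigr => x _.
    by rewrite rmorphM /= toRC_prob.
  rewrite mxtrace_scale_suml; apply: eq_bigr => k _; rewrite rmorphM /= Emk.
  by rewrite toRC_prob ?toM_outer_vec //; apply: psd_outer.
move=> X s X0 /RleP s0; apply/RleP; rewrite -lecR !toRC_sumR.
rewrite (eq_bigr (fun k => (b k + toRC s)^-1 * \tr (row_proj U k *m toM d X))).
  rewrite [leRHS](eq_bigr (fun x : 'I_n =>
    (toRC (l x) + toRC s)^-1 * \tr (toM d (M x) *m toM d X))).
    by apply: Hb; [rewrite ler0c | apply/psdP].
  by move=> x _; rewrite RdivE rmorphM fmorphV rmorphD /= toRC_prob // mulrC.
move=> k _; rewrite RdivE rmorphM fmorphV rmorphD /= Emk.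
by rewrite toRC_prob ?toM_outer_vec 1?mulrC //; apply: psd_outer.
Qed.

(** For the offending effect [M x] with eigenvalues [m k], tr(M x rho) > 0 makes some [m k] and
    tr(P_k rho) both positive. As tr(M x sigma) = 0 is a sum of nonnegative terms, tr(P_k sigma) = 0
    for that [k]. *)
Lemma DM_EInf_DP d rho sigma n M : psd d rho -> psd d sigma -> povm d n M ->
  kl_inf n (fun x => prob d (M x) rho) (fun x => prob d (M x) sigma) = true ->
  exists2 Ps, proj_family d Ps &
    kl_inf d (fun k => prob d (Ps k) rho) (fun k => prob d (Ps k) sigma) = true.
Proof.
move=> rho0 sigma0 [M0 _] /kl_inf_true [x [xn [Px Qx]]].
have [Ps [m [HPs m0 Em]]] := psd_spectral (M0 _ xn).
have [P0 _] := povm_proj_family HPs.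
exists Ps => //; apply/kl_inf_true.
have [|k kd pk] := sumR_gt0_exists d (fun k => Rmult (m k) (prob d (Ps k) rho)).
  rewrite -(Em _ rho0); have := prob_ge0 (M0 _ xn) rho0; lra.
exists k; split=> //; split; first by move=> pk0; rewrite pk0 in pk; lra.
have qk0 := prob_ge0 (P0 _ kd) sigma0; have mk0 := m0 _ kd.
have mq : Rle (Rmult (m k) (prob d (Ps k) sigma)) 0.
  rewrite -Qx (Em _ sigma0).
  apply: (sumR_ge_term d (fun k => Rmult (m k) (prob d (Ps k) sigma))) => // l ld.
  by apply: Rmult_le_pos; [apply: m0 | apply: prob_ge0 => //; apply: P0].
have mk1 : Rlt 0 (m k).
  by case: mk0 => // mk0; rewrite -mk0 in pk; lra.
nra.
Qed.

(* The projective measurement is the eigenbasis of [sum_x l x * M x], where [l] is the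
   likelihood ratio of the two outcome distributions, [eps] off the support. *)
Lemma KL_povm_le d rho sigma n M eps : density d rho -> psd d sigma -> povm d n M ->
  kl_inf n (fun x => prob d (M x) rho) (fun x => prob d (M x) sigma) = false ->
  Rlt 0 eps -> exists2 Ps, proj_family d Ps &
    kl_inf d (fun k => prob d (Ps k) rho) (fun k => prob d (Ps k) sigma) = false ->
    Rle (sumR n (fun x => kl_term (prob d (M x) rho) (prob d (M x) sigma)))
      (Rplus (sumR d (fun k => kl_term (prob d (Ps k) rho) (prob d (Ps k) sigma)))
             (Rmult eps (Defs.Re (trace d sigma)))).
Proof.
move=> [rho0 rho1] sigma0 HM Mfin eps0; have [M0 _] := HM.
pose P x := prob d (M x) rho; pose Q x := prob d (M x) sigma.
have P_ge0 x : (x < n)%coq_nat -> Rle 0 (P x).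
  by move=> xn; apply: prob_ge0 => //; apply: M0.
have Q_ge0 x : (x < n)%coq_nat -> Rle 0 (Q x).
  by move=> xn; apply: prob_ge0 => //; apply: M0.
have PQ x : (x < n)%coq_nat -> P x <> IZR 0 -> Q x <> IZR 0.
  exact: kl_inf_false Mfin.
pose l x := likelihood_ratio eps (P x) (Q x).
have l0 x : (x < n)%coq_nat -> Rlt 0 (l x).
  by move=> xn; apply: likelihood_ratio_gt0; auto.
have [Ps [m [HPs m0 Em Hm]]] := povm_projective_compare HM l0.
exists Ps => // Pfin; have HPM := povm_proj_family HPs; have [Ps0 _] := HPM.
pose p k := prob d (Ps k) rho; pose q k := prob d (Ps k) sigma.
have p_ge0 k : (k < d)%coq_nat -> Rle 0 (p k).
  by move=> kd; apply: prob_ge0 => //; apply: Ps0.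
have q_ge0 k : (k < d)%coq_nat -> Rle 0 (q k).
  by move=> kd; apply: prob_ge0 => //; apply: Ps0.
have P1 : sumR n P = IZR 1 by rewrite (sum_prob_povm HM) // rho1.
have p1 : sumR d p = IZR 1 by rewrite (sum_prob_povm HPM) // rho1.
(* The operator Jensen inequality for the logarithm. *)
have step1 : Rle (sumR n (fun x => kl_term (P x) (Q x)))
                 (sumR d (fun k => Rmult (p k) (ln (m k)))).
  rewrite (sumR_ext n _ (fun x => Rmult (P x) (ln (l x)))); last first.
    by move=> x _; apply: kl_term_likelihood_ratio.
  by apply: ln_mean_le => // s s0; apply: Hm.
have step2 := KL_variational_le d p q m p_ge0 q_ge0 m0 Pfin.
have step3 : Rle (sumR d (fun k => Rmult (m k) (q k)))
                 (Rplus 1 (Rmult eps (Defs.Re (trace d sigma)))).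
  rewrite (Em _ sigma0) -P1 -(sum_prob_povm HM) // -sumR_scal -sumR_plus.
  by apply: sumR_le => x xn; apply: likelihood_ratio_mult_le; auto; lra.
(* The 1 in [step3] cancels the total mass of [p] subtracted in [step2]. *)
move: step1 step2 step3; rewrite p1 /P /Q /p /q; lra.
Qed.

(** * Equality of the two suprema *)

Theorem theorem2 (d : nat) (rho sigma : Mat)
  (Hrho : density d rho) (Hsigma : psd d sigma) :
  exists v : ereal, is_esup (DP_set d rho sigma) v /\ is_esup (DM_set d rho sigma) v.
Proof.
(* The standard basis shows that [DP_set] is inhabited, so its supremum exists. *)
have DP0 : DP_set d rho sigma (KL d
    (fun k => prob d (outer (vec (1%:M : 'M_d) k)) rho)
    (fun k => prob d (outer (vec (1%:M : 'M_d) k)) sigma)).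
  exists (fun k => outer (vec (1%:M : 'M_d) k)); split=> //.
  apply: proj_family_unitary.
  by apply/unitarymxP; rewrite trmx1 map_mx1 mulmx1.
have [v Hv] := esup_exists _ _ DP0; have [ub least] := Hv.
(* Projective families are POVMs, so a bound for [DM_set] bounds [DP_set]. It remains to see that
   [v] bounds [DM_set], which is immediate if [v = EInf]. *)
exists v; split=> //; split; last first.
  move=> u Hu; apply: least => _ [Ps [HPs ->]]; apply: Hu.
  by exists d, Ps; split=> //; apply: povm_proj_family.
move=> _ [n [M [HM ->]]].
case: v Hv ub least => [r|] Hv ub least; last by case: KL.
have DP_le Ps : proj_family d Ps ->
    kl_inf d (fun k => prob d (Ps k) rho) (fun k => prob d (Ps k) sigma) = false /\
    Rle (sumR d (fun k => kl_term (prob d (Ps k) rho) (prob d (Ps k) sigma))) r.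
  move=> HPs; have := ub _ (ex_intro _ Ps (conj HPs erefl)).
  by rewrite /KL; case: kl_inf.
rewrite /KL; case Minf: kl_inf.
  have [Ps /DP_le [Pfin _]] := DM_EInf_DP (proj1 Hrho) Hsigma HM Minf.
  by rewrite Pfin.
have t0 : Rle 0 (Defs.Re (trace d sigma)).
  rewrite -(sum_prob_povm HM Hsigma); apply: sumR_ge0 => x xn.
  by apply: prob_ge0 => //; case: HM => M0 _; apply: M0.
apply: le_epsilon => eps eps0.
(* Using [eps / t] in [KL_povm_le] keeps the error below [eps]; the added 1 makes [t] positive even
   when tr(sigma) = 0. *)
pose t := Rplus (Defs.Re (trace d sigma)) 1.
have tpos : Rlt 0 t by rewrite /t; lra.
have [Ps HPs] := KL_povm_le Hrho Hsigma HM Minf (Rdiv_lt_0_compat _ _ eps0 tpos).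
have [Pfin Ple] := DP_le _ HPs => /(_ Pfin).
have : Rle (Rmult (Rdiv eps t) (Defs.Re (trace d sigma))) eps.
  have -> : Defs.Re (trace d sigma) = Rminus t 1 by rewrite /t; lra.
  have -> : Rmult (Rdiv eps t) (Rminus t 1) = Rminus eps (Rdiv eps t) by field; lra.
  have := Rdiv_lt_0_compat _ _ eps0 tpos; lra.
lra.
Qed.
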